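(* Let $T:[0,1]\to[0,1]$ be a unimodal map fixing $0$, and let $X$ be the inverse limit space with the single bonding map $T$. For every point $a\in X$ there exists an embedding $g:X\to\mathbb{R}^2$ such that $g(a)$ is an accessible point of $g(X)$.
   Context: A unimodal map $T:[0,1]\to[0,1]$ is a continuous map with a unique critical (turning) point $c\in(0,1)$, strictly increasing on $[0,c]$ and strictly decreasing on $[c,1]$. Standing assumption: $T(0)=0$ and $T$ has exactly two fixed points, $0$ and $r$. The inverse limit space with bonding map $T$ is $X:=\{(\ldots,x_{-2},x_{-1},x_0): x_{-i}\in[0,1],\ T(x_{-(i+1)})=x_{-i},\ i=0,1,2,\ldots\}$ with metric $d(x,y)=\sum_{i\le 0}2^{i}|x_i-y_i|$. An embedding of $X$ in the plane is a homeomorphism of $X$ onto a subset of $\mathbb{R}^2$. For a planar continuum $K\subset\mathbb{R}^2$, a point $p\in K$ is accessible (from the complement of $K$) if there is an arc $A=[x,y]\subset\mathbb{R}^2$ (a homeomorphic image of a compact interval, with endpoints $x,y$) such that $p=x$ and $A\cap K=\{p\}$. *)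

(* Defs.v *)
From HB Require Import structures.
From mathcomp Require Import all_boot all_order all_algebra.
From mathcomp Require Import all_classical all_reals all_analysis.
From mathcomp Require Import lra.

Set Implicit Arguments.
Unset Strict Implicit.
Unset Printing Implicit Defensive.
Import Order.TTheory GRing.Theory Num.Theory.
Import numFieldNormedType.Exports.
Local Open Scope classical_set_scope.
Local Open Scope ring_scope.

(* A map of the interval [0, 1] is represented by a function T : R -> R whose
   values outside [0, 1] are irrelevant. *)
Definition unimodal (R : realType) (T : R -> R) : Prop :=
  [/\ {in `[0, 1], forall x, T x \in `[0, 1]},
      {within `[0, 1], continuous T} &
      exists c : R, [/\ 0 < c < 1,
        {in `[0, c] &, {homo T : x y / x < y >-> x < y}} &
        {in `[c, 1] &, {homo T : x y / x < y >-> y < x}}]].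

Definition fixed_points (R : realType) (T : R -> R) : set R :=
  [set x | x \in `[0, 1] /\ T x = x].

(* The coordinate written x_{-i} in (..., x_{-2}, x_{-1}, x_0) is coord x i. *)
Record invlim (R : realType) (T : R -> R) : Type := Invlim {
  coord : nat -> R ;
  coordP : forall i, coord i \in `[0, 1] /\ T (coord i.+1) = coord i }.

HB.instance Definition _ (R : realType) (T : R -> R) :=
  gen_eqMixin (invlim T).
HB.instance Definition _ (R : realType) (T : R -> R) :=
  gen_choiceMixin (invlim T).

Definition invlim_dist (R : realType) (T : R -> R) (x y : invlim T) : R :=
  limn (series (fun i => 2^-1 ^+ i * `|coord x i - coord y i|)).

Section invlim_metric.
Context {R : realType} {T : R -> R}.
Implicit Types x y z : invlim T.

Lemma coord_inj : injective (@coord R T).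
Proof.
move=> [x xP] [y yP] /= xy; rewrite xy in xP *; congr Invlim.
exact: Prop_irrelevance.
Qed.

Let term x y : R^nat := fun i => 2^-1 ^+ i * `|coord x i - coord y i|.

Let term_ge0 x y i : 0 <= term x y i.
Proof. by rewrite mulr_ge0// exprn_ge0// invr_ge0. Qed.

Lemma invlim_dist_cvg x y : cvgn (series (term x y)).
Proof.
have half_lt1 : `|2^-1 : R| < 1 by rewrite ger0_norm ?invr_ge0// invf_lt1// ltr1n.
apply: (@series_le_cvg _ (term x y) (geometric 1 2^-1)).
- exact: term_ge0.
- by move=> i; rewrite /geometric/= mul1r exprn_ge0// invr_ge0.
- move=> i; rewrite /geometric/= /term mul1r ler_piMr ?exprn_ge0 ?invr_ge0//.
  have [+ _] := coordP x i; have [+ _] := coordP y i.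
  by rewrite !in_itv/= ler_norml => /andP[y0 y1] /andP[x0 x1]; lra.
- exact: is_cvg_geometric_series.
Qed.

Let distE x y : invlim_dist x y = limn (series (term x y)).
Proof. by []. Qed.

Lemma invlim_distxx x : invlim_dist x x = 0.
Proof.
rewrite distE (_ : series _ = cst 0) ?lim_cst//.
by apply/funext => n; rewrite /series/= big1// => i _; rewrite /term subrr normr0 mulr0.
Qed.

Lemma invlim_dist_eq0 x y : invlim_dist x y = 0 -> x = y.
Proof.
move=> xy; apply/coord_inj/funext => i.
have : series (term x y) i.+1 <= invlim_dist x y.
  by apply: nondecreasing_cvgn_le; [exact: nondecreasing_series|exact: invlim_dist_cvg].
rewrite xy /series/= big_nat_recr//= => h.
have : term x y i <= 0.
  by rewrite (le_trans _ h)// lerDr sumr_ge0.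
rewrite /term pmulr_rle0 ?exprn_gt0 ?invr_gt0// normr_le0 subr_eq0.
by move=> /eqP.
Qed.

Lemma invlim_dist_sym x y : invlim_dist x y = invlim_dist y x.
Proof.
rewrite !distE; congr (limn (series _)).
by apply/funext => i; rewrite /term distrC.
Qed.

Lemma invlim_dist_triangle y x z :
  invlim_dist x z <= invlim_dist x y + invlim_dist y z.
Proof.
rewrite !distE -limD; try exact: invlim_dist_cvg.
apply: ler_lim; first exact: invlim_dist_cvg.
  by apply: is_cvgD; exact: invlim_dist_cvg.
apply: nearW => n; rewrite /series/= -[leRHS]big_split/= ler_sum// => i _.
by rewrite /term -mulrDr ler_wpM2l ?exprn_ge0 ?invr_ge0// ler_distD.
Qed.

End invlim_metric.

HB.instance Definition _ (R : realType) (T : R -> R) :=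
  @isMetric.Build R (invlim T) (@invlim_dist R T) (@invlim_distxx R T)
    (@invlim_dist_eq0 R T) (@invlim_dist_sym R T) (@invlim_dist_triangle R T).

Definition homeomorphism (S U : topologicalType) (h : S -> U) : Prop :=
  continuous h /\
  exists k : U -> S, [/\ continuous k, cancel h k & cancel k h].

(* The corestriction of f to its range, which carries the subspace topology,
   is a homeomorphism. *)
Definition embedding (S U : topologicalType) (f : S -> U) : Prop :=
  exists h : S -> set_type (range f),
    homeomorphism h /\ forall x, set_val (h x) = f x.

(* Only the restriction of f to [u, v] matters; u < v excludes the degenerate
   arc reduced to a point. *)
Definition is_arc (R : realType) (U : topologicalType) (A : set U) (x y : U)
    : Prop :=
  exists (u v : R) (f : R -> U),
    [/\ u < v, embedding (fun t : set_type `[u, v] => f (set_val t)),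
        f @` `[u, v] = A, f u = x & f v = y].
Arguments is_arc R {U} A x y.

Definition accessible (R : realType) (K : set (R * R)) (p : R * R) : Prop :=
  K p /\ exists (A : set (R * R)) (y : R * R),
    is_arc R A p y /\ A `&` K = [set p].

(* Main.v *)
(* Extend T to a map E of the line that is strictly monotone on both sides of
   the turning point. The map (t, y) |-> (E t, 0) is a uniform limit of
   Henon-like maps F that embed the plane in itself, and by Brown's
   approximation argument the inverse limit X follows the inverse limit of a
   sequence F_0, F_1, ... of such maps chosen close enough to it: if x is in X,
   there are p_n near (x_n, 0) with F_n p_{n+1} = p_n, and g x = p_0 depends
   continuously on x. As each F_n is an embedding, p_0 determines all the p_n,
   hence x.
   The fold F_n can put either branch of T on top. Choosing the branch of
   a_{n+1}, one arranges that F_n maps the vertical ray above (a_{n+1}, 0) into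
   the one above (a_n, 0), contracting it at least by half. Then g a = (a_0, 0),
   and a point (a_0, s) of g(X) with s > 0 would give points p_n = (a_n, s_n)
   with s_n >= 2^n s, whereas the p_n are bounded: g a is accessible along a
   vertical segment. *)
Require Import Defs.
From HB Require Import structures.
From mathcomp Require Import all_boot all_order all_algebra.
From mathcomp Require Import all_classical all_reals all_analysis.
From mathcomp Require Import lra ring.

Set Implicit Arguments.
Unset Strict Implicit.
Unset Printing Implicit Defensive.
Import Order.TTheory GRing.Theory Num.Theory.
Import numFieldNormedType.Exports.
Local Open Scope classical_set_scope.
Local Open Scope ring_scope.
Local Notation coord := Defs.coord.

(** * Sequences with geometrically decreasing increments *)

Lemma geometric_small (R : realType) (C e : R) :
  0 < e -> exists n, C * 2^-1 ^+ n < e.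
Proof.
move=> e0; exists (Num.bound `|C / e|); set n := Num.bound _.
rewrite exprVn ltr_pdivrMr ?exprn_gt0// mulrC -ltr_pdivrMr//.
rewrite (le_lt_trans (ler_norm _))// (lt_le_trans (archi_boundP _))//.
by rewrite -natrX ler_nat ltnW// ltn_expl.
Qed.

Lemma geometric_le0 (R : realType) (x C : R) :
  (forall n, x <= C * 2^-1 ^+ n) -> x <= 0.
Proof.
move=> xC; apply/ler_addgt0Pr => e e0; rewrite add0r.
by have [n /ltW] := geometric_small C e0; exact: le_trans.
Qed.

(** With [b n] the sum of the bounds on the increments from [n] on, the intervals of radius [b n]
    around [u n] are nested. The supremum of their left ends lies in all of them. *)
Lemma geometric_limit (R : realType) (u : R^nat) (C : R) :
  (forall n, `|u n.+1 - u n| <= C * 2^-1 ^+ n) ->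
  exists l, forall n, `|l - u n| <= C * 2 * 2^-1 ^+ n.
Proof.
move=> uC; pose b n : R := C * 2 * 2^-1 ^+ n.
have C0 : 0 <= C by have := uC 0%N; rewrite expr0 mulr1; exact: le_trans.
have ub n k : `|u (n + k)%N - u n| <= b n - b (n + k)%N.
  elim: k => [|k IH]; first by rewrite addn0 !subrr normr0.
  rewrite addnS; have := uC (n + k)%N.
  have : b (n + k).+1 = b (n + k)%N - C * 2^-1 ^+ (n + k).
    by rewrite /b exprS; field.
  move: IH; rewrite !ler_norml => /andP[? ?] bE /andP[? ?].
  by apply/andP; split; lra.
have b0 n : 0 <= b n by rewrite /b !mulr_ge0// exprn_ge0// invr_ge0.
have ulu m n : u m - b m <= u n + b n.
  have [mn|/ltnW nm] := leqP m n.
    have := ub m (n - m)%N; rewrite subnKC// ler_norml => /andP[? ?].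
    by have := b0 m; have := b0 n; lra.
  have := ub n (m - n)%N; rewrite subnKC// ler_norml => /andP[? ?].
  by have := b0 m; have := b0 n; lra.
pose S := range (fun n => u n - b n).
exists (sup S) => n; rewrite ler_norml; apply/andP; split.
- rewrite lerBrDr addrC -/(b n); apply: ub_le_sup; last by exists n.
  by exists (u 0%N + b 0%N) => _ [m _ <-].
- rewrite lerBlDl -/(b n); apply: ge_sup; first by exists (u 0%N - b 0%N), 0%N.
  by move=> _ [m _ <-].
Qed.

Lemma prod_norm_le (R : realType) (p : R * R) (e : R) :
  (`|p| <= e) = (`|p.1| <= e) && (`|p.2| <= e).
Proof. by rewrite prod_normE ge_max. Qed.

Lemma prod_norm_lt (R : realType) (p : R * R) (e : R) :
  (`|p| < e) = (`|p.1| < e) && (`|p.2| < e).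
Proof. by rewrite prod_normE gt_max. Qed.

Lemma prod_dist_lt (R : realType) (p q : R * R) (e : R) :
  (`|p - q| < e) = (`|p.1 - q.1| < e) && (`|p.2 - q.2| < e).
Proof. by rewrite prod_norm_lt. Qed.

Lemma geometric_limit_plane (R : realType) (u : (R * R)^nat) (C : R) :
  (forall n, `|u n.+1 - u n| <= C * 2^-1 ^+ n) ->
  exists l, forall n, `|l - u n| <= C * 2 * 2^-1 ^+ n.
Proof.
move=> uC.
have [|l1 l1P] := @geometric_limit R (fun n => (u n).1) C.
  by move=> n; have := uC n; rewrite prod_norm_le => /andP[].
have [|l2 l2P] := @geometric_limit R (fun n => (u n).2) C.
  by move=> n; have := uC n; rewrite prod_norm_le => /andP[].
by exists (l1, l2) => n; rewrite prod_norm_le l1P l2P.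
Qed.

(** * Uniform continuity, and continuity of inverses *)

Definition unif_cont (R : realType) (U V : normedModType R) (f : U -> V) :=
  forall e : R, 0 < e -> exists2 d : R, 0 < d &
    forall p q, `|p - q| < d -> `|f p - f q| < e.

(** Injectivity and continuity of the inverse on the image in a single condition, stable under
    composition; [d] may depend on [p]. *)
Definition inv_cont (R : realType) (U V : normedModType R) (f : U -> V) :=
  forall p (e : R), 0 < e -> exists2 d : R, 0 < d &
    forall q, `|f p - f q| < d -> `|p - q| < e.

Lemma inv_cont_inj (R : realType) (U V : normedModType R) (f : U -> V) :
  inv_cont f -> injective f.
Proof.
move=> fi p q fpq; apply/eqP; rewrite -subr_eq0 -normr_le0 leNgt.
apply/negP => /fi-/(_ p)[d d0 /(_ q)].
by rewrite fpq subrr normr0 ltxx => /(_ d0).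
Qed.

Lemma unif_cont_id (R : realType) (U : normedModType R) :
  unif_cont (id : U -> U).
Proof. by move=> e e0; exists e. Qed.

Lemma unif_cont_comp (R : realType) (U V W : normedModType R)
    (f : V -> W) (g : U -> V) :
  unif_cont f -> unif_cont g -> unif_cont (f \o g).
Proof.
move=> fu gu e /fu[d d0 fd]; have [d' d'0 gd'] := gu _ d0.
by exists d' => // p q /gd' /fd.
Qed.

Lemma unif_cont_iter (R : realType) (U : normedModType R) (f : U -> U) n :
  unif_cont f -> unif_cont (iter n f).
Proof.
move=> fu; elim: n => [|n IH]; first exact: unif_cont_id.
exact: (unif_cont_comp fu IH).
Qed.

Lemma unif_equicont (R : realType) (U V : normedModType R)
    (f : nat -> U -> V) n (e : R) :
  (forall k, unif_cont (f k)) -> 0 < e -> exists2 d : R, 0 < d &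
    forall k, (k <= n)%N -> forall p q, `|p - q| < d -> `|f k p - f k q| < e.
Proof.
move=> fu e0; elim: n => [|n [d d0 IH]].
  have [d d0 fd] := fu 0%N _ e0.
  by exists d => // k; rewrite leqn0 => /eqP ->.
have [d' d'0 fd'] := fu n.+1 _ e0.
exists (Num.min d d'); first by rewrite lt_min d0.
move=> k; rewrite leq_eqVlt => /orP[/eqP -> | kn] p q;
  rewrite lt_min => /andP[pd pd']; [exact: fd'|exact: IH].
Qed.

(** * Inverse sequences of maps and Brown's approximation *)

(** The composite of [F k], ..., [F (k + j).-1], which takes term [k + j] of an orbit
    [F n (p n.+1) = p n] to term [k]. The recursion adds the innermost map; [tail_head] splits off
    the outermost one. *)
Fixpoint tail (T : Type) (F : nat -> T -> T) k j (p : T) :=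
  if j is j'.+1 then tail F k j' (F (k + j')%N p) else p.

Lemma tail_head (T : Type) (F : nat -> T -> T) k j p :
  tail F k j.+1 p = F k (tail F k.+1 j p).
Proof.
elim: j p => [|j IH] p /=; first by rewrite addn0.
by have /= -> := IH (F (k + j.+1)%N p); rewrite addSnnS.
Qed.

Lemma unif_cont_tail (R : realType) (U : normedModType R)
    (F : nat -> U -> U) k j :
  (forall n, unif_cont (F n)) -> unif_cont (tail F k j).
Proof.
move=> Fu; elim: j => [|j IH]; first exact: unif_cont_id.
exact: (unif_cont_comp IH (Fu _)).
Qed.

(* [F n] is chosen after [F 0, ..., F n.-1]: uniform continuity of the finitely
   many maps [tail F k j] and [iter j G] with [k + j = n] tells how close to
   [G] it has to be. *)
Lemma close_perturbations (R : realType) (V : normedModType R) (D : set V)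
    (G : V -> V) (Q : nat -> (V -> V) -> Prop) :
  unif_cont G ->
  (forall n F, Q n F -> unif_cont F) ->
  (forall n (e : R), 0 < e -> exists2 F, Q n F &
     forall p, D p -> `|F p - G p| < e) ->
  exists F : nat -> V -> V, (forall n, Q n (F n)) /\
    forall k j p, D p ->
      `|tail F k j (F (k + j)%N p) - tail F k j (G p)| <= 2^-1 ^+ (k + j) /\
      `|iter j G (F (k + j)%N p) - iter j G (G p)| <= 2^-1 ^+ (k + j).
Proof.
move=> Gu Qu QG.
have pow0 n : (0 : R) < 2^-1 ^+ n by rewrite exprn_gt0// invr_gt0.
have /choice[next nextP] : forall a : nat * (nat -> V -> V), exists F : V -> V,
    (forall k, unif_cont (a.2 k)) -> Q a.1 F /\
    forall k, (k <= a.1)%N -> forall p, D p ->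
      `|a.2 k (F p) - a.2 k (G p)| <= 2^-1 ^+ a.1 /\
      `|iter k G (F p) - iter k G (G p)| <= 2^-1 ^+ a.1.
  (* The value [id] is a default for families that are not uniformly continuous; by [stu] below,
     these never occur in the construction. *)
  move=> [n f] /=; have [fu|nfu] := pselect (forall k, unif_cont (f k)); last first.
    by exists id => /nfu.
  have [d d0 fd] := unif_equicont n fu (pow0 n).
  have [d' d'0 Gd] := unif_equicont n (fun k => unif_cont_iter k Gu) (pow0 n).
  have [|F QF FG] := QG n (Num.min d d'); first by rewrite lt_min d0.
  exists F => _; split=> // k kn p /FG; rewrite lt_min => /andP[pd pd'].
  by split; apply: ltW; [exact: fd|exact: Gd].
(* The state [st n] keeps all the composites ending at stage [n]: its entry [k] is
   [tail F k (n - k)] for [k <= n], and [id] beyond. *)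
pose step n (f : nat -> V -> V) k :=
  if (k <= n)%N then f k \o next (n, f) else id.
pose st := fix st n := if n is n'.+1 then step n' (st n') else fun=> id.
pose F n := next (n, st n).
have stu n : forall k, unif_cont (st n k).
  elim: n => [|n IH] k /=; first exact: unif_cont_id.
  rewrite /step; case: ifP => _; last exact: unif_cont_id.
  apply: (unif_cont_comp (IH k)).
  by have [/Qu] := nextP (n, st n) IH.
have stE k j : st (k + j)%N k = tail F k j.
  elim: j => [|j IH]; apply/funext => p /=.
    by rewrite addn0; case: k => //= k; rewrite /step ltnn.
  by rewrite addnS /= /step leq_addr -IH.
exists F; split=> [n|k j p Dp]; first by have [] := nextP (n, st n) (stu n).
have [_ /= FP] := nextP ((k + j)%N, st (k + j)%N) (stu _).
have [+ _] := FP k (leq_addr _ _) p Dp.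
have [_ +] := FP j (leq_addl _ _) p Dp.
by rewrite stE -/(F (k + j)%N).
Qed.

(* M. Brown's approximation theorem: the inverse limit of [G] is followed by
   that of the nearby maps [F n]. *)
Lemma shadowing (R : realType) (r : R) (G : R * R -> R * R)
    (F : nat -> R * R -> R * R) (x : nat -> R * R) :
  let D : set (R * R) := [set p | `|p| <= r] in
  unif_cont G -> (forall n, unif_cont (F n)) ->
  (forall n p, D p -> D (F n p)) ->
  (forall k j p, D p ->
      `|tail F k j (F (k + j)%N p) - tail F k j (G p)| <= 2^-1 ^+ (k + j) /\
      `|iter j G (F (k + j)%N p) - iter j G (G p)| <= 2^-1 ^+ (k + j)) ->
  (forall n, D (x n)) -> (forall n, G (x n.+1) = x n) ->
  exists p : nat -> R * R, [/\ forall n, D (p n),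
    forall n, F n (p n.+1) = p n,
    forall k j, `|p k - tail F k j (x (k + j)%N)| <= 2 * 2^-1 ^+ (k + j) &
    forall k j, `|iter j G (p (k + j)%N) - x k| <= 2 * 2^-1 ^+ (k + j)].
Proof.
move=> D Gu Fu FD FG xD xG.
have pow0 n : (0 : R) < 2^-1 ^+ n by rewrite exprn_gt0// invr_gt0.
have tailD k j q : D q -> D (tail F k j q).
  by elim: j q => //= j IH q /(FD (k + j)%N) /IH.
(* Since [x (k + j) = G (x (k + j).+1)], passing from [j] to [j.+1] replaces one innermost [G] by
   [F (k + j)], at a cost of [2^-1 ^+ (k + j)]. So [p k] is the limit over [j]. *)
have /choice[p pP] : forall k, exists pk : R * R, forall j,
    `|pk - tail F k j (x (k + j)%N)| <= 2 * 2^-1 ^+ (k + j).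
  move=> k.
  have [|l lP] := @geometric_limit_plane R
      (fun j => tail F k j (x (k + j)%N)) (2^-1 ^+ k).
    by move=> j; rewrite addnS /= -(xG (k + j)%N) -exprD; have [] := FG k j _ (xD (k + j).+1).
  by exists l => j; rewrite (le_trans (lP j))// exprD mulrAC mulrC mulrA.
have iterG k j : iter j G (x (k + j)%N) = x k.
  by elim: j => [|j IH]; rewrite ?addn0// addnS iterSr xG.
(* The maps [F] are exchanged for [G] one at a time, outermost first. The first exchange costs
   [2^-1 ^+ (k + j)], and the induction hypothesis at [j.+1] bounds the others by the same
   amount. *)
have GF k j m :
    `|iter j G (tail F (k + j) m (x (k + j + m)%N)) - x k| <= 2 * 2^-1 ^+ (k + j).
  elim: m j => [|m IH] j.
    by rewrite addn0 /= iterG subrr normr0 mulr_ge0// ltW.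
  rewrite tail_head addnS; set q := tail _ _ _ _.
  have := IH j.+1; rewrite !addnS addSn iterSr -/q.
  have Dq : D q by exact: tailD.
  have [_ FGq] := FG k j q Dq => Gq.
  rewrite (le_trans (ler_distD (iter j G (G q)) _ _))//.
  by rewrite (le_trans (lerD FGq Gq))// exprS mulrA divff// mul1r mulr2n mulrDl mul1r.
exists p; split.
- move=> k; rewrite /D/= -subr_le0; apply: (@geometric_le0 _ _ 2) => j.
  have := pP k j; have := tailD k j _ (xD (k + j)%N); rewrite /D/= => Dt pt.
  have := lerB_dist (p k) (tail F k j (x (k + j)%N)).
  have : 2 * 2^-1 ^+ (k + j) <= 2 * 2^-1 ^+ j :> R.
    by rewrite ler_pM2l// exprD ler_piMl ?exprn_ile1 ?invr_ge0 ?invf_le1 ?ler1n// ltW.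
  by lra.
(* [F k] maps the approximations of [p k.+1] to those of [p k]; its continuity passes this to the
   limit. *)
- move=> k; apply/eqP; rewrite -subr_eq0 -normr_le0; apply/ler_addgt0Pr => e e0.
  rewrite add0r; have e20 : 0 < e / 2 by rewrite divr_gt0.
  have [d d0 Fd] := Fu k _ e20.
  have [j1 j1d] := geometric_small 2 d0.
  have [j2 j2e] := geometric_small 2 e20.
  pose j := maxn j1 j2.
  have powle i : (i <= j)%N -> forall m, 2 * 2^-1 ^+ (m + j) <= 2 * 2^-1 ^+ i :> R.
    move=> ij m; rewrite ler_pM2l// ler_wiXn2l ?invr_ge0 ?invf_le1 ?ler1n//.
    exact: leq_trans ij (leq_addl _ _).
  have h1 := Fd (p k.+1) (tail F k.+1 j (x (k.+1 + j)%N)).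
  have /h1 {h1} : `|p k.+1 - tail F k.+1 j (x (k.+1 + j)%N)| < d.
    rewrite (le_lt_trans (pP _ _))// (le_lt_trans _ j1d)//.
    by apply: powle; exact: leq_maxl.
  rewrite -tail_head addSnnS => h1.
  have h2 : `|p k - tail F k j.+1 (x (k + j.+1)%N)| < e / 2.
    rewrite (le_lt_trans (pP _ _))// -addSnnS (le_lt_trans _ j2e)//.
    by apply: powle; exact: leq_maxr.
  rewrite distrC in h2.
  rewrite (le_trans (ler_distD (tail F k j.+1 (x (k + j.+1)%N)) _ _))//.
  by rewrite ltW// (splitr e) ltrD.
- by [].
(* This is [GF] in the limit of large [m], as [iter j G] is continuous. *)
- move=> k j; apply/ler_addgt0Pr => e e0.
  have [d d0 Gd] := unif_cont_iter j Gu e0.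
  have [m md] := geometric_small 2 d0.
  rewrite (le_trans (ler_distD (iter j G (tail F (k + j) m (x (k + j + m)%N))) _ _))//.
  rewrite [leRHS]addrC lerD ?GF// ltW// Gd// (le_lt_trans (pP _ _))// (le_lt_trans _ md)//.
  rewrite ler_pM2l// ler_wiXn2l ?invr_ge0 ?invf_le1 ?ler1n//.
  exact: leq_addl.
Qed.

(** * Extension of the unimodal map to the line *)

(** Half of a radius that works at [p] serves all points near [p]; compactness, as a near-covering
    property along radii tending to [0] from the right, yields a common radius. *)
Lemma heine (R : realType) (U V : normedModType R) (K : set U) (f : U -> V) :
  compact K -> {within K, continuous f} ->
  forall e : R, 0 < e -> exists2 d : R, 0 < d &
    forall p q, K p -> K q -> `|p - q| < d -> `|f p - f q| < e.
Proof.
move=> /compact_near_coveringP cK /subspace_continuousP fK e e0.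
have [] := cK R (0:R)^'+ (fun d p => K p ->
    forall q, K q -> `|p - q| < d -> `|f p - f q| < e).
  move=> p Kp.
  have /cvgrPdist_lt/(_ (e / 2)) := fK p Kp.
  rewrite divr_gt0// => /(_ isT); rewrite near_withinE.
  move=> /nbhs_normP[/= d d0 fd].
  exists (ball_ Num.norm p (d / 2), [set t | t < d / 2]) => /=.
    split; first by apply/nbhs_normP; exists (d / 2) => //=; rewrite divr_gt0.
    by apply: nbhs_right_lt; rewrite divr_gt0.
  move=> [p' t] [/= pp' td] Kp' q Kq p'q.
  have h1 : `|f p - f p'| < e / 2.
    by apply: fd => //=; rewrite (lt_trans pp')// ltr_pdivrMr// ltr_pMr// ltr1n.
  have h2 : `|f p - f q| < e / 2.
    apply: fd => //=; rewrite (le_lt_trans (ler_distD p' _ _))//.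
    by rewrite (splitr d) ltrD// (lt_trans p'q).
  by rewrite (le_lt_trans (ler_distD (f p) _ _))// (splitr e) ltrD// distrC.
move=> d /= d0 dP; exists (d / 2); first by rewrite divr_gt0.
move=> p q Kp Kq; apply: (dP (d / 2)) => //=; last by rewrite divr_gt0.
by rewrite sub0r normrN gtr0_norm ?divr_gt0// ltr_pdivrMr// ltr_pMr// ltr1n.
Qed.

Definition clamp (R : realType) (t : R) : R := Num.max 0 (Num.min 1 t).

Lemma clamp_cases (R : realType) (t : R) :
  [\/ t <= 0 /\ clamp t = 0, 0 < t < 1 /\ clamp t = t | 1 <= t /\ clamp t = 1].
Proof.
rewrite /clamp; have [t0|t0] := leP t 0.
  apply: Or31; split=> //; rewrite min_r; last by lra.
  by apply/max_idPl.
have [t1|t1] := ltP t 1.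
  by apply: Or32; split=> //; rewrite max_r ?(ltW t0)// ltW.
by apply: Or33; split=> //; rewrite max_r// ler01.
Qed.

Lemma clamp_itv (R : realType) (t : R) : clamp t \in `[0, 1].
Proof. by rewrite in_itv/=; have [] := clamp_cases t => -[? ->]; lra. Qed.

Lemma clamp_id (R : realType) (t : R) : t \in `[0, 1] -> clamp t = t.
Proof.
by rewrite in_itv/= => /andP[? ?]; have [] := clamp_cases t => -[? ->] //; lra.
Qed.

Lemma clamp_dist (R : realType) (s t : R) : `|clamp s - clamp t| <= `|s - t|.
Proof.
wlog st : s t / s <= t.
  move=> W; have [/W //|/ltW/W] := leP s t.
  by rewrite distrC [`|t - s|]distrC.
rewrite [leRHS]distrC (ger0_norm (_ : 0 <= t - s)) ?subr_ge0// ler_norml.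
by have [] := clamp_cases s => -[? ->]; have [] := clamp_cases t => -[? ->];
  apply/andP; split; lra.
Qed.

(* Subtracting the distance to [0, 1] makes it strictly monotone outside. *)
Definition extend (R : realType) (T : R -> R) (t : R) : R :=
  T (clamp t) - `|t - clamp t| / 2.

Section extend_unimodal.
Context (R : realType) (T : R -> R).
Hypothesis hT : unimodal T.
Let E := extend T.

Lemma extend_id t : t \in `[0, 1] -> E t = T t.
Proof. by move=> t01; rewrite /E/extend clamp_id// subrr normr0 mul0r subr0. Qed.

(** Leaves a margin: a map of the plane closer than 1 to [(t, y) |-> (E t, 0)] still sends the
    square of radius 2 into itself. *)
Lemma extend_bound t : `|t| <= 2 -> `|E t| <= 1.
Proof.
have [T01 _ _] := hT.
have := T01 _ (clamp_itv t); rewrite in_itv/= => /andP[T0 T1].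
rewrite !ler_norml => /andP[? ?]; rewrite /E/extend.
have : `|t - clamp t| <= 2.
  by rewrite ler_norml; have [] := clamp_cases t => -[? ->]; apply/andP; split; lra.
by have := normr_ge0 (t - clamp t) => *; apply/andP; split; lra.
Qed.

Lemma extend_unif_cont : unif_cont E.
Proof.
have [_ Tc _] := hT.
move=> e e0; have e20 : 0 < e / 2 by rewrite divr_gt0.
have [d d0 Td] := heine (@segment_compact _ 0 1) Tc e20.
exists (Num.min d (e / 2)); first by rewrite lt_min d0.
move=> s t; rewrite lt_min => /andP[std ste].
have := clamp_dist s t => cst.
have : `|T (clamp s) - T (clamp t)| < e / 2.
  by apply: Td; [exact: clamp_itv|exact: clamp_itv|exact: le_lt_trans std].
have : `| `|s - clamp s| - `|t - clamp t| | < e.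
  rewrite (le_lt_trans (ler_dist_dist _ _))//.
  rewrite (_ : _ - _ = (s - t) - (clamp s - clamp t)); last by ring.
  rewrite (le_lt_trans (ler_normB _ _))// (splitr e) ltrD//.
  exact: le_lt_trans ste.
rewrite /E/extend !ltr_norml => /andP[? ?] /andP[? ?].
by apply/andP; split; lra.
Qed.

(* [s] is the direction away from the turning point on the branch of [a]. *)
Lemma extend_branch a : exists2 s, s = 1 \/ s = -1 &
  forall z z' : R, 0 <= z -> z < z' -> E (a + s * z') < E (a + s * z).
Proof.
have [T01 _ [c [/andP[c0 c1] Tinc Tdec]]] := hT.
have lo x y : x < y -> y <= c -> E x < E y.
  move=> xy yc; rewrite /E/extend.
  case: (clamp_cases x) => -[hx clx]; case: (clamp_cases y) => -[hy cly];
    rewrite clx cly; try lra.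
  - by rewrite !ler0_norm; lra.
  - have : T 0 < T y by apply: Tinc; rewrite ?in_itv/=; lra.
    by rewrite ler0_norm ?subrr ?normr0; lra.
  - have : T x < T y by apply: Tinc; rewrite ?in_itv/=; lra.
    by rewrite !subrr !normr0; lra.
have hi x y : c <= x -> x < y -> E y < E x.
  move=> cx xy; rewrite /E/extend.
  case: (clamp_cases x) => -[hx clx]; case: (clamp_cases y) => -[hy cly];
    rewrite clx cly; try lra.
  - have : T y < T x by apply: Tdec; rewrite ?in_itv/=; lra.
    by rewrite !subrr !normr0; lra.
  - have : T 1 < T x by apply: Tdec; rewrite ?in_itv/=; lra.
    by rewrite ger0_norm ?subrr ?normr0; lra.
  - by rewrite !ger0_norm; lra.
have [ac|ca] := leP a c.
  exists (-1); first by right.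
  by move=> z z' z0 zz'; apply: lo; lra.
exists 1; first by left.
by move=> z z' z0 zz'; apply: hi; lra.
Qed.

End extend_unimodal.

(** * The Henon-like fold *)

Lemma max0_cases (R : realType) (y : R) :
  (y <= 0 /\ (Num.max 0 y = 0 /\ Num.min 0 y = y)) \/
  (0 < y /\ (Num.max 0 y = y /\ Num.min 0 y = 0)).
Proof.
by have [y0|y0] := leP y 0; [left|right].
Qed.

(** A point at distance at least [e] from [y] has its image beyond [f (y - e)] or [f (y + e)], hence
    at least the smaller of the two gaps away from [f y]. *)
Lemma strict_mono_inv_cont (R : realType) (f : R -> R) :
  {homo f : x y / x < y} -> inv_cont f.
Proof.
move=> fm y e e0.
exists (Num.min (f (y + e) - f y) (f y - f (y - e))).
  by rewrite lt_min !subr_gt0; apply/andP; split; apply: fm; lra.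
have fle x x' : x <= x' -> f x <= f x'.
  by rewrite le_eqVlt => /orP[/eqP -> //|/fm/ltW].
move=> y'; rewrite lt_min => /andP[] ; rewrite !ltr_norml => /andP[? ?] /andP[? ?].
have h1 : ~~ (y + e <= y') by apply/negP => /fle; lra.
have h2 : ~~ (y' <= y - e) by apply/negP => /fle; lra.
by move: h1 h2; rewrite -!ltNge => ? ?; apply/andP; split; lra.
Qed.

(* A Henon-like map [(t, y) |-> (E w + b y, e v)]: the second coordinate
   determines [w], then the first one determines [y]. The term [E a - E (a + s * z)]
   is what straightens the image of the vertical ray above [(a, 0)]. *)
Definition fold (R : realType) (E : R -> R) (s a e : R) (p : R * R) : R * R :=
  let z := e * Num.max 0 p.2 in
  (E (p.1 + s * z) + (E a - E (a + s * z) + e * Num.min 0 p.2),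
   e * (s * (p.1 - a) + z)).

Section fold.
Context (R : realType) (E : R -> R) (s a e : R).
Hypotheses (Eu : unif_cont E) (s1 : s = 1 \/ s = -1) (e0 : 0 < e) (e1 : e <= 2^-1).
Hypothesis Es : forall z z' : R, 0 <= z -> z < z' -> E (a + s * z') < E (a + s * z).

Lemma fold_ray (y : R) : 0 <= y -> fold E s a e (a, y) = (E a, e * e * y).
Proof.
move=> y0; rewrite /fold/= max_r// min_l// subrr !mulr0 addr0 add0r.
by congr pair; rewrite ?mulrA// addrCA subrr addr0.
Qed.

Let zdist (y y' : R) : `|e * Num.max 0 y - e * Num.max 0 y'| <= `|y - y'| / 2.
Proof.
rewrite -mulrBr normrM (gtr0_norm e0) mulrC ler_pM ?(ltW e0)//.
wlog yy' : y y' / y <= y'.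
  move=> W; have [/W //|/ltW/W] := leP y y'.
  by rewrite distrC [`|y' - y|]distrC.
rewrite [leRHS]distrC (ger0_norm (_ : 0 <= y' - y)) ?subr_ge0// ler_norml.
by have [|] := max0_cases y => -[? [-> _]]; have [|] := max0_cases y' => -[? [-> _]];
  apply/andP; split; lra.
Qed.

Let mdist (y y' : R) : `|e * Num.min 0 y - e * Num.min 0 y'| <= `|y - y'| / 2.
Proof.
rewrite -mulrBr normrM (gtr0_norm e0) mulrC ler_pM ?(ltW e0)//.
wlog yy' : y y' / y <= y'.
  move=> W; have [/W //|/ltW/W] := leP y y'.
  by rewrite distrC [`|y' - y|]distrC.
rewrite [leRHS]distrC (ger0_norm (_ : 0 <= y' - y)) ?subr_ge0// ler_norml.
by have [|] := max0_cases y => -[? [_ ->]]; have [|] := max0_cases y' => -[? [_ ->]];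
  apply/andP; split; lra.
Qed.

Let sN x : `|s * x| = `|x|.
Proof. by case: s1 => ->; rewrite ?mul1r// mulN1r normrN. Qed.

Lemma fold_unif_cont : unif_cont (fold E s a e).
Proof.
move=> h h0; have h40 : 0 < h / 4 by rewrite divr_gt0.
have [d d0 Ed] := Eu h40.
exists (Num.min (d / 2) (h / 4)); first by rewrite lt_min divr_gt0.
suff H (t y t' y' : R) : `|t - t'| < d / 2 -> `|t - t'| < h / 4 ->
    `|y - y'| < d / 2 -> `|y - y'| < h / 4 ->
    `|fold E s a e (t, y) - fold E s a e (t', y')| < h.
  move=> [t y] [t' y']; rewrite prod_dist_lt/= !lt_min.
  by move=> /andP[/andP[td th] /andP[yd yh]]; exact: H.
move=> td th yd yh; rewrite prod_dist_lt/= /fold/=.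
have zz := zdist y y'; have mm := mdist y y'.
move: zz mm; set z := e * Num.max 0 y; set z' := e * Num.max 0 y'.
set m := e * Num.min 0 y; set m' := e * Num.min 0 y'; move=> zz mm.
have szz : `|s * z - s * z'| = `|z - z'| by rewrite -mulrBr sN.
apply/andP; split.
  have w1 : `|E (t + s * z) - E (t' + s * z')| < h / 4.
    apply: Ed; rewrite opprD addrACA (le_lt_trans (ler_normD _ _))// szz.
    by have := normr_ge0 (y - y'); lra.
  have w2 : `|E (a + s * z) - E (a + s * z')| < h / 4.
    apply: Ed; rewrite opprD addrACA subrr add0r szz.
    by have := normr_ge0 (y - y'); lra.
  have {}mm : `|m - m'| < h / 4 by lra.
  move: w1 w2 mm; rewrite !ltr_norml.
  by move=> /andP[? ?] /andP[? ?] /andP[? ?]; apply/andP; split; lra.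
rewrite -mulrBr normrM (gtr0_norm e0).
have : `|s * (t - a) + z - (s * (t' - a) + z')| < h.
  rewrite (_ : _ - _ = s * (t - t') + (z - z')); last by ring.
  rewrite (le_lt_trans (ler_normD _ _))// sN.
  by lra.
by move=> vh; rewrite (le_lt_trans _ vh)// ler_piMl//; have := e1; lra.
Qed.

Lemma fold_inv_cont : inv_cont (fold E s a e).
Proof.
(* For [y >= 0] this is [E a - E (a + s * (e * y))], increasing by [Es]; for [y <= 0] it is [e * y].
   The two agree at [0]. *)
pose b (y : R) := E a - E (a + s * (e * Num.max 0 y)) + e * Num.min 0 y.
have /strict_mono_inv_cont bi : {homo b : y y' / y < y'}.
  move=> y y' yy'; rewrite /b.
  have [|] := max0_cases y => -[y0 [-> ->]]; have [|] := max0_cases y' => -[y'0 [-> ->]].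
  - by rewrite ltrD2l ltr_pM2l.
  - have /Es : 0 <= e * 0 by rewrite mulr0.
    move=> /(_ (e * y')); rewrite mulr0 mulr_gt0// => /(_ isT).
    have : e * y <= 0 by rewrite pmulr_rle0. lra.
  - by lra.
  - have /Es : 0 <= e * y by rewrite mulr_ge0// ltW.
    move=> /(_ (e * y')); rewrite ltr_pM2l// => /(_ yy'); lra.
suff H (t y h : R) : 0 < h -> exists2 d : R, 0 < d & forall t' y' : R,
    `|fold E s a e (t, y) - fold E s a e (t', y')| < d ->
    `|(t, y) - (t', y')| < h.
  by move=> [t y] h /(H t y)[d d0 dH]; exists d => // -[t' y']; exact: dH.
move=> h0; have h20 : 0 < h / 2 by rewrite divr_gt0.
have [d0 d00 bd] := bi y _ h20.
have d020 : 0 < d0 / 2 by rewrite divr_gt0.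
have [d1 d10 Ed] := Eu d020.
(* As [s * s = 1], the second coordinate is [e * s * (w - a)] with [w = t + s * z], so [w] is known
   up to [d1] and [h / 2]. Then [E w] is known up to [d0 / 2], [b y] up to [d0], [y] up to [h / 2],
   [z] up to [h / 4], and finally [t = w - s * z] up to [h]. *)
exists (Num.min (d0 / 2) (e * Num.min d1 (h / 2))).
  by rewrite lt_min d020 mulr_gt0// lt_min d10.
move=> t' y'; rewrite prod_dist_lt/= /fold/= -!/(b _) !lt_min.
move=> /andP[/andP[u0 _] /andP[_ v1]].
have zz := zdist y y'.
move: u0 v1 zz; set z := e * Num.max 0 y; set z' := e * Num.max 0 y' => u0 v1 zz.
have {v1} : `|(t + s * z) - (t' + s * z')| < Num.min d1 (h / 2).
  move: v1; rewrite -mulrBr normrM (gtr0_norm e0) ltr_pM2l//.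
  rewrite (_ : _ - (s * (t' - a) + z') = s * ((t + s * z) - (t' + s * z'))) ?sN//.
  by case: s1 => ->; ring.
rewrite lt_min => /andP[/Ed w0 w1].
have yy' : `|y - y'| < h / 2.
  apply: bd; move: u0 w0; rewrite !ltr_norml => /andP[? ?] /andP[? ?].
  by apply/andP; split; lra.
rewrite prod_dist_lt/=; apply/andP; split; last by lra.
have szz : `|s * z - s * z'| = `|z - z'| by rewrite -mulrBr sN.
have : `|s * z - s * z'| <= h / 4 by lra.
by move: w1; rewrite !ltr_norml ler_norml => /andP[? ?] /andP[? ?]; apply/andP; split; lra.
Qed.

(** The first coordinate is off by two increments of [E] over steps of length at most [2 * e < d],
    and by a term of size at most [2 * e <= h / 6]. The second one is at most [4 * e <= h / 3]. *)
Lemma fold_close (h d : R) : `|a| <= 1 -> 0 < h ->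
  (forall x x' : R, `|x - x'| < d -> `|E x - E x'| < h / 3) ->
  e <= d / 4 -> e <= h / 12 ->
  forall p, `|p| <= 2 -> `|fold E s a e p - (E p.1, 0)| < h.
Proof.
move=> a1 h0 Ed ed eh [t y]; rewrite prod_norm_le/= => /andP[t2 y2].
rewrite prod_dist_lt/= /fold/= subr0.
have mm := mdist y 0; have zz := zdist y 0.
move: zz mm; rewrite maxxx minxx mulr0 !subr0.
set z := e * Num.max 0 y; set m := e * Num.min 0 y => _ _.
have z2 : `|z| <= e * 2.
  rewrite normrM (gtr0_norm e0) ler_pM2l// ler_norml; move: y2; rewrite ler_norml.
  by have [|] := max0_cases y => -[? [-> _]] /andP[? ?]; apply/andP; split; lra.
have m2 : `|m| <= e * 2.
  rewrite normrM (gtr0_norm e0) ler_pM2l// ler_norml; move: y2; rewrite ler_norml.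
  by have [|] := max0_cases y => -[? [_ ->]] /andP[? ?]; apply/andP; split; lra.
have [e2 e3] := (e0, e1).
have zd : `|z| < d by lra.
have shift x : `|E (x + s * z) - E x| < h / 3.
  by apply: Ed; rewrite addrC addKr sN.
apply/andP; split.
  have := shift t; have := shift a; move: m2; rewrite ler_norml !ltr_norml.
  by move=> /andP[? ?] /andP[? ?] /andP[? ?]; apply/andP; split; lra.
rewrite normrM (gtr0_norm e0).
have : `|s * (t - a) + z| <= 4.
  rewrite (le_trans (ler_normD _ _))// sN.
  by have := ler_normB t a; lra.
by rewrite -(ler_pM2l e0); lra.
Qed.

End fold.

Lemma fold_exists (R : realType) (T : R -> R) (a h : R) :
  unimodal T -> a \in `[0, 1] -> 0 < h ->
  exists2 F : R * R -> R * R,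
    [/\ unif_cont F, inv_cont F &
      exists2 k, 0 < k <= 2^-1 & forall y, 0 <= y -> F (a, y) = (T a, k * y)] &
    forall p, `|p| <= 2 -> `|F p - (extend T p.1, 0)| < h.
Proof.
move=> hT a01 h0; have Eu := extend_unif_cont hT.
have [s s1 Es] := extend_branch hT a.
have h30 : 0 < h / 3 by rewrite divr_gt0.
have [d d0 Ed] := Eu _ h30.
(* The last two bounds are those of [fold_close]; the first makes the contraction factor [e * e] of
   the ray at most one half. *)
pose e := Num.min 2^-1 (Num.min (d / 4) (h / 12)).
have e0 : 0 < e by rewrite /e !lt_min; apply/and3P; split; lra.
have /and3P[e2 ed eh] : [&& e <= 2^-1, e <= d / 4 & e <= h / 12].
  by rewrite -!le_min.
clearbody e.
exists (fold (extend T) s a e).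
  split; [exact: fold_unif_cont|exact: fold_inv_cont|].
  exists (e * e) => [|y y0]; last by rewrite fold_ray// extend_id.
  rewrite mulr_gt0//= (le_trans _ e2)// ler_piMl ?(ltW e0)//; lra.
apply: fold_close Ed ed eh => //.
by move: a01; rewrite in_itv/= ler_norml => /andP[? ?]; apply/andP; split; lra.
Qed.

(** * Composites, embeddings and the vertical arc *)

Lemma inv_cont_comp (R : realType) (U V W : normedModType R)
    (f : V -> W) (g : U -> V) :
  inv_cont f -> inv_cont g -> inv_cont (f \o g).
Proof.
move=> fi gi p e /(gi p)[d d0 gd]; have [d' d'0 fd] := fi (g p) _ d0.
by exists d' => // q /fd /gd.
Qed.

Lemma inv_cont_tail (R : realType) (U : normedModType R)
    (F : nat -> U -> U) k j :
  (forall n, inv_cont (F n)) -> inv_cont (tail F k j).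
Proof.
move=> Fi; elim: j => [|j IH]; first by move=> p e e0; exists e.
exact: (inv_cont_comp IH (Fi _)).
Qed.

Lemma tail_orbit (T : Type) (F : nat -> T -> T) (p : nat -> T) k j :
  (forall n, F n (p n.+1) = p n) -> tail F k j (p (k + j)%N) = p k.
Proof. by move=> Fp; elim: j => [|j IH] /=; rewrite ?addn0// addnS Fp. Qed.

Lemma nbhs_set_type (U : topologicalType) (K : set U) (x : set_type K)
    (A : set (set_type K)) :
  nbhs x A <-> exists2 B, nbhs (set_val x) B & forall y, B (set_val y) -> A y.
Proof.
split=> [[_ [[B oB <-] Bx BA]]|[B]].
  by exists B => //; exact: open_nbhs_nbhs.
rewrite nbhsE => -[C [oC Cx] CB BA].
exists (set_val @^-1` C); split=> [|//|y /CB /BA //].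
by exists C.
Qed.

(** The last hypothesis expresses continuity of the inverse by neighbourhoods in [U], which avoids
    the topology of [range f]. The inverse itself comes from choice. *)
Lemma embeddingI (S U : topologicalType) (f : S -> U) :
  continuous f -> injective f ->
  (forall x A, nbhs x A ->
    exists2 B, nbhs (f x) B & forall y, B (f y) -> A y) ->
  embedding f.
Proof.
move=> fc fI fA.
pose h x : set_type (range f) := SigSub (mem_set (imageT f x)).
have hE x : set_val (h x) = f x by [].
have kP (y : set_type (range f)) : exists x, f x = set_val y.
  by have [x _ xy] := set_valP y; exists x.
have [k fk] := choice kP.
have kh : cancel k h by move=> y; apply/val_inj; exact: fk.
exists h; split=> //; split.
  move=> x A /nbhs_set_type[B /fc fB BA].
  by apply: (@filterS _ (nbhs x) _ _ _ _ fB) => y; exact: (BA (h y)).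
exists k; split=> [y A kyA|x|]; [|by apply: fI; rewrite fk hE|exact: kh].
have [B] := fA _ _ kyA; rewrite fk => yB BA.
by apply/nbhs_set_type; exists B => // z; have := BA (k z); rewrite fk.
Qed.

Lemma vertical_segment_arc (R : realType) (a : R) :
  is_arc R ((fun t : R => (a, t)) @` `[0, 1] : set (R * R)) (a, 0) (a, 1).
Proof.
exists 0, 1, (fun t => (a, t)); split => //.
apply: embeddingI => [t|t t' [] /val_inj //|t A /nbhs_set_type[B tB BA]].
  have ca : a @[_ --> nbhs t] --> a by exact: cvg_cst.
  exact: (cvg_pair ca (@initial_continuous _ _ set_val t)).
exists [set p | B p.2]; last by move=> t' /BA.
by exists (setT, B) => /=; [split=> //; exact: filterT|move=> p []].
Qed.

(** * The metric of the inverse limit in terms of coordinates *)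

Section invlim_coordinates.
Context (R : realType) (T : R -> R).
Implicit Types x y : invlim T.

Let d x y : R^nat := fun i => 2^-1 ^+ i * `|coord x i - coord y i|.

Lemma coord_dist_le x y i :
  2^-1 ^+ i * `|coord x i - coord y i| <= invlim_dist x y.
Proof.
have d0 j : 0 <= d x y j by rewrite mulr_ge0// exprn_ge0// invr_ge0.
have : series (d x y) i.+1 <= invlim_dist x y.
  apply: nondecreasing_cvgn_le; last exact: invlim_dist_cvg.
  exact: nondecreasing_series.
by apply: le_trans; rewrite /series/= big_nat_recr//= lerDr sumr_ge0.
Qed.

(** The weights add up to at most 2 in the head and [2 * 2^-1 ^+ n] in the tail, where coordinates
    in [[0, 1]] differ by at most 1. *)
Lemma invlim_dist_le x y n e : 0 <= e ->
  (forall i, (i < n)%N -> `|coord x i - coord y i| <= e) ->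
  invlim_dist x y <= 2 * e + 2 * 2^-1 ^+ n.
Proof.
move=> e0 xy.
have pow0 i : (0 : R) < 2^-1 ^+ i by rewrite exprn_gt0// invr_gt0.
have xy1 i : `|coord x i - coord y i| <= 1.
  have [+ _] := Defs.coordP x i; have [+ _] := Defs.coordP y i.
  by rewrite !in_itv/= ler_norml => /andP[? ?] /andP[? ?]; apply/andP; split; lra.
apply: limr_le; first exact: invlim_dist_cvg.
apply: nearW => m.
have head j : (j <= n)%N -> series (d x y) j <= 2 * e - 2 * e * 2^-1 ^+ j.
  elim: j => [|j IH] jn.
    by rewrite /series/= big_geq// expr0 mulr1 subrr.
  rewrite /series/= big_nat_recr//=.
  have := IH (ltnW jn); rewrite /series/= => h.
  have : d x y j <= 2^-1 ^+ j * e by rewrite /d ler_pM2l// xy.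
  have -> : 2 * e * 2^-1 ^+ j.+1 = e * 2^-1 ^+ j by rewrite exprS; field.
  by lra.
have [/head mn|nm] := leqP m n.
  rewrite (le_trans mn)//.
  have := ltW (pow0 n); have : 0 <= 2 * e * 2^-1 ^+ m.
    by rewrite !mulr_ge0// ltW.
  by lra.
rewrite -(subnKC (ltnW nm)); move: (m - n)%N => {nm}k.
suff : series (d x y) (n + k)%N <= 2 * e + 2 * 2^-1 ^+ n - 2 * 2^-1 ^+ (n + k).
  by have := ltW (pow0 (n + k)%N); lra.
elim: k => [|k IH].
  rewrite addn0 addrK.
  apply: (le_trans (head n (leqnn n))).
  by rewrite lerBlDr lerDl !mulr_ge0// ltW.
rewrite addnS /series/= big_nat_recr//=.
have : d x y (n + k)%N <= 2^-1 ^+ (n + k) by rewrite /d ler_piMr// ltW.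
have -> : 2 * 2^-1 ^+ (n + k).+1 = 2^-1 ^+ (n + k) :> R by rewrite exprS; field.
by move: IH; rewrite /series/=; lra.
Qed.

End invlim_coordinates.

(** * The embedding, and accessibility along the vertical segment *)

Theorem theorem1 (R : realType) (T : R -> R) (hT : unimodal T)
    (hT0 : T 0 = 0)
    (hfix : exists r : R, r != 0 /\ fixed_points T = [set 0; r])
    (a : invlim T) :
  exists g : invlim T -> R * R,
    embedding g /\ accessible (range g) (g a).
Proof.
pose G (p : R * R) : R * R := (extend T p.1, 0).
pose D : set (R * R) := [set p | `|p| <= 2].
have coord01 (x : invlim T) n : coord x n \in `[0, 1] by have [] := Defs.coordP x n.
have coordT (x : invlim T) n : T (coord x n.+1) = coord x n by have [] := Defs.coordP x n.
have Gu : unif_cont G.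
  move=> e e0; have [d d0 Ed] := extend_unif_cont hT e0.
  exists d => // p q; rewrite prod_dist_lt => /andP[pq _].
  by rewrite prod_dist_lt/= subrr normr0 e0 andbT Ed.
have GD p : D p -> `|G p| <= 1.
  rewrite /D/= !prod_norm_le/= normr0 ler01 andbT => /andP[p2 _].
  exact: extend_bound.
pose Q n (F : R * R -> R * R) :=
  [/\ unif_cont F, inv_cont F, forall p, D p -> D (F p) &
    exists2 k, 0 < k <= 2^-1 &
      forall y, 0 <= y -> F (coord a n.+1, y) = (coord a n, k * y)].
have [|||F [FQ FG]] := @close_perturbations R (R * R)%type D G Q.
- exact: Gu.
- by move=> n F [].
- move=> n e e0; have m0 : 0 < Num.min e 1 by rewrite lt_min e0 ltr01.
  have [F [Fu Fi Fa] FG] := fold_exists hT (coord01 a n.+1) m0.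
  exists F => [|p Dp]; last by have := FG p Dp; rewrite lt_min => /andP[].
  split=> // [p Dp|]; last by rewrite -(coordT a n).
  have := GD p Dp; have := FG p Dp; rewrite lt_min => /andP[_ F1] G1.
  have := ler_normD (F p - G p) (G p); rewrite subrK /D/=.
  by move: (F1 : `|F p - G p| < 1); lra.
have Fu n : unif_cont (F n) by have [] := FQ n.
have Fi n : inv_cont (F n) by have [] := FQ n.
have FD n p : D p -> D (F n p) by have [_ _ + _] := FQ n; exact.
pose lift (x : invlim T) n : R * R := (coord x n, 0).
have liftD x n : D (lift x n).
  rewrite /D/= prod_norm_le/= normr0 ler0n andbT.
  by move: (coord01 x n); rewrite in_itv/= ler_norml => /andP[? ?]; apply/andP; split; lra.
have liftG x n : G (lift x n.+1) = lift x n.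
  by rewrite /G/lift/= extend_id ?coordT.
have /choice[P PP] : forall x : invlim T, exists p : nat -> R * R,
    [/\ forall n, D (p n), forall n, F n (p n.+1) = p n,
    forall k j, `|p k - tail F k j (lift x (k + j)%N)| <= 2 * 2^-1 ^+ (k + j) &
    forall k j, `|iter j G (p (k + j)%N) - lift x k| <= 2 * 2^-1 ^+ (k + j)].
  by move=> x; exact: (@shadowing R 2 G F (lift x) Gu Fu FD FG (liftD x) (liftG x)).
pose g x := P x 0%N.
(* [g x] is a uniform limit of [tail F 0 n (lift x n)], each of which depends continuously on the
   single coordinate [coord x n]. *)
have gc : continuous g.
  move=> x A /nbhs_ballP[e /= e0 eA]; have e30 : 0 < e / 3 by rewrite divr_gt0.
  have [n ne] := geometric_small 2 e30.
  have [d d0 Fd] := unif_cont_tail 0%N n Fu e30.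
  apply/nbhs_ballP; exists (2^-1 ^+ n * d) => /=.
    by rewrite mulr_gt0// exprn_gt0// invr_gt0.
  move=> y; rewrite ballEmdist/= -[mdist x y]/(invlim_dist x y) => xy.
  apply: eA; rewrite -ball_normE/=.
  have {xy} xy : `|coord x n - coord y n| < d.
    rewrite -(@ltr_pM2l _ (2^-1 ^+ n)) ?exprn_gt0 ?invr_gt0//.
    exact: le_lt_trans (coord_dist_le x y n) xy.
  have [_ _ /(_ 0%N n) xn _] := PP x; have [_ _ /(_ 0%N n) yn _] := PP y.
  have := Fd (lift x n) (lift y n); rewrite prod_dist_lt/= xy subrr normr0 d0.
  move=> /(_ isT) tn; rewrite add0n in xn yn.
  rewrite (le_lt_trans (ler_distD (tail F 0%N n (lift x n)) _ _))//.
  have := ler_distD (tail F 0%N n (lift y n)) (tail F 0%N n (lift x n)) (g y).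
  rewrite [in X in _ <= _ + X -> _]distrC -/(g x) -/(g y) in xn yn *.
  by lra.
(* Closeness of [g x] and [g y] is pulled back through [tail F 0 n] to [P x n] and [P y n], then
   pushed by iterates of [G] to coordinates [i < n]. Three errors below [e / 24] give [e / 8] for
   each of them, and the tail of the metric is below [e / 24]. *)
have gi x e : 0 < e -> exists2 d, 0 < d &
    forall y, `|g x - g y| < d -> invlim_dist x y < e.
  move=> e0; have e80 : 0 < e / 8 by rewrite divr_gt0.
  have e240 : 0 < e / 24 by rewrite divr_gt0.
  have [n ne] := geometric_small 2 e240.
  have [d1 d10 Gd] := unif_equicont n (fun k => unif_cont_iter k Gu) e240.
  have [d d0 Fd] := inv_cont_tail 0%N n Fi (P x n) d10.
  exists d => // y gxy.
  have [_ xF _ xG] := PP x; have [_ yF _ yG] := PP y.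
  have /Fd Pxy : `|tail F 0%N n (P x n) - tail F 0%N n (P y n)| < d.
    by have := tail_orbit 0%N n xF; have := tail_orbit 0%N n yF; rewrite !add0n => -> ->.
  have e81 : 0 <= e / 8 by rewrite ltW.
  rewrite (le_lt_trans (@invlim_dist_le _ _ x y n _ e81 _))//; last by lra.
  move=> i /ltnW i_n.
  have := xG i (n - i)%N; have := yG i (n - i)%N; rewrite subnKC// => yi xi.
  have Gxy := Gd (n - i)%N (leq_subr _ _) _ _ Pxy.
  have : `|lift x i - lift y i| < e / 8.
    rewrite (le_lt_trans (ler_distD (iter (n - i) G (P x n)) _ _))//.
    have := ler_distD (iter (n - i) G (P y n)) (iter (n - i) G (P x n)) (lift y i).
    by rewrite distrC in xi; lra.
  by rewrite prod_dist_lt/= => /andP[/ltW].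
have gI : injective g.
  move=> x y gxy; apply: invlim_dist_eq0; apply/eqP; rewrite eq_le.
  apply/andP; split.
    apply/ler_addgt0Pr => e e0; have [d d0 /(_ y)] := gi x e e0.
    by rewrite gxy subrr normr0 add0r => /(_ d0)/ltW.
  have := coord_dist_le x y 0%N; apply: le_trans.
  by rewrite mulr_ge0// exprn_ge0// invr_ge0.
(* [lift a] is itself an orbit of the maps [F n], so all the approximations of [g a] equal
   [lift a 0]. *)
have ga : g a = (coord a 0%N, 0).
  have Fa n : F n (lift a n.+1) = lift a n.
    by have [_ _ _ [k _ ->]] := FQ n => //; rewrite mulr0.
  apply/eqP; rewrite -subr_eq0 -normr_le0; apply: (@geometric_le0 _ _ 2) => n.
  have [_ _ /(_ 0%N n) + _] := PP a.
  by rewrite (tail_orbit 0%N n Fa).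
exists g; split.
  apply: embeddingI => // x A /nbhs_ballP[e e0 eA].
  have [d d0 gd] := gi x e e0.
  exists (ball (g x) d); first exact: nbhsx_ballx.
  move=> y; rewrite -ball_normE/= => /gd xy; apply: eA.
  by rewrite ballEmdist.
split; first by exists a.
exists ((fun t : R => (coord a 0%N, t)) @` `[0, 1]), (coord a 0%N, 1); split.
  by rewrite ga; exact: vertical_segment_arc.
apply/seteqP; split=> [p [[s]]|p ->]; last first.
  split; last by exists a.
  by rewrite ga; exists 0 => //=; rewrite in_itv/= lexx ler01.
rewrite /= in_itv/= => /andP[s0 s1] <- [x _ gx]; rewrite ga.
move: s0; rewrite le_eqVlt => /orP[/eqP <- //|s0]; exfalso.
have [xD xF _ _] := PP x.
(* The point [(coord a n.+1, t / k)] is a preimage of [P x n] under [F n], and the only one by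
   injectivity, so it is [P x n.+1]. As [k <= 2^-1], the height at least doubles. *)
have ray n : exists2 t, s * 2 ^+ n <= t & P x n = (coord a n, t).
  elim: n => [|n [t st Pxn]]; first by exists s; rewrite ?expr0 ?mulr1.
  have [_ _ _ [k /andP[k0 k2] Fk]] := FQ n.
  have t0 : 0 <= t by rewrite (le_trans _ st)// mulr_ge0 ?exprn_ge0// ltW.
  exists (t / k).
    rewrite ler_pdivlMr// (le_trans _ st)//.
    rewrite (_ : _ * k = s * 2 ^+ n * (2 * k)); last by rewrite exprS; ring.
    by rewrite ler_piMr ?mulr_ge0 ?exprn_ge0 ?(ltW s0)//; lra.
  have tk0 : 0 <= t / k by rewrite divr_ge0// ltW.
  apply: (inv_cont_inj (Fi n)); rewrite xF Pxn Fk// mulrC divfK//.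
  by rewrite gt_eqF.
(* For this [n] the height is at least [s * 2 ^+ n > 2], outside the square [D]. *)
have [n sn] := geometric_small 2 s0; rewrite exprVn ltr_pdivrMr ?exprn_gt0// in sn.
have [t st Pxn] := ray n.
have := xD n; rewrite /D/= Pxn prod_norm_le/= => /andP[_].
by have := ler_norm t; lra.
Qed.
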